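(* For all complex $q$ with $|q|<1$, $$\mathcal{P}(q)\mathcal{P}(q^2)=\mathcal{Q}(q^2)+q\frac{d\mathcal{P}(q)}{dq}+2q\frac{d\mathcal{P}(q^2)}{dq},$$ $$\mathcal{P}(q^2)\mathcal{E}(q)=\mathcal{Q}(q^2)+\frac23\Big(q\frac{d\mathcal{E}(q)}{dq}+2q\frac{d\mathcal{E}(q^2)}{dq}\Big)+\Big(q\frac{d\mathcal{P}(q)}{dq}-2q\frac{d\mathcal{P}(q^2)}{dq}\Big),$$ $$\mathcal{P}(q)\mathcal{E}(q^2)=\frac12\big(3\mathcal{Q}(q^2)-\mathcal{Q}(q)\big)+2q\frac{d\mathcal{E}(q^2)}{dq}.$$
   Context: For $s,n\in\mathbb{N}$ (positive integers), $\widetilde{\sigma}_s(n)=\sum_{d\mid n}(-1)^{d-1}d^s$ and $\widehat{\sigma}_s(n)=\sum_{d\mid n}(-1)^{\frac nd-1}d^s$; write $\widetilde{\sigma}=\widetilde{\sigma}_1$, $\widehat{\sigma}=\widehat{\sigma}_1$. For $|q|<1$, $$\mathcal{P}(q)=1+8\sum_{n=1}^\infty\widetilde{\sigma}(n)q^n,\quad \mathcal{E}(q)=1+24\sum_{n=1}^\infty\widehat{\sigma}(n)q^n,\quad \mathcal{Q}(q)=1-16\sum_{n=1}^\infty\widetilde{\sigma}_3(n)q^n.$$ The notation $\frac{d\mathcal{P}(q^2)}{dq}$ means the derivative with respect to $q$ of the composite function $q\mapsto\mathcal{P}(q^2)$, and similarly for $\mathcal{E}$. *)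

(* Defs.v *)
From Stdlib Require Export Reals ZArith List.
From Coquelicot Require Export Coquelicot.

Open Scope C_scope.

(* The positive divisors of n, for n >= 1. *)
Definition divisors (n : nat) : list nat :=
  filter (fun d => Nat.eqb (n mod d) 0) (seq 1 n).

Definition sigma_tilde (s n : nat) : Z :=
  fold_right Z.add 0%Z
    (map (fun d => ((-1) ^ Z.of_nat (d - 1) * Z.of_nat d ^ Z.of_nat s)%Z)
       (divisors n)).

Definition sigma_hat (s n : nat) : Z :=
  fold_right Z.add 0%Z
    (map (fun d => ((-1) ^ Z.of_nat (n / d - 1) * Z.of_nat d ^ Z.of_nat s)%Z)
       (divisors n)).

(* Coquelicot's total operator [Series] is restricted to real terms; this is
   its complex counterpart, meaningful when the series converges. *)
Definition CSeries (a : nat -> C) : C :=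
  @iota C_CompleteNormedModule (@is_series C_AbsRing C_NormedModule a).

Lemma CSeries_unique (a : nat -> C) (l : C) :
  @is_series C_AbsRing C_NormedModule a l -> CSeries a = l.
Proof.
intros H; unfold CSeries.
apply (@iota_filterlim_locally C_AbsRing C_CompleteNormedModule nat
         eventually _ (@sum_n C_NormedModule a) l H).
Qed.

(* sum_{n >= 1} c n * q ^ n, reindexed by n = k + 1. *)
Definition gen_series (c : nat -> Z) (q : C) : C :=
  CSeries (fun k => RtoC (IZR (c (S k))) * q ^ S k).

Definition calP (q : C) : C := 1 + 8 * gen_series (sigma_tilde 1) q.
Definition calE (q : C) : C := 1 + 24 * gen_series (sigma_hat 1) q.
Definition calQ (q : C) : C := 1 - 16 * gen_series (sigma_tilde 3) q.

Definition calP2 (q : C) : C := calP (q ^ 2).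
Definition calE2 (q : C) : C := calE (q ^ 2).

(* Complex differentiability. [C_derive f q] is defined as the limit of the
   difference quotient along the real direction only; it is the complex
   derivative as soon as [C_ex_derive f q] (lemma [C_derive_correct]). *)
Definition C_ex_derive (f : C -> C) (q : C) : Prop :=
  @ex_derive C_AbsRing C_NormedModule f q.

(* Main.v *)
Require Import Defs.
From Stdlib Require Import Permutation Lia Lra.

(** The two sides of each identity are power series in [q], so the identities
are statements about coefficients.  Writing P, E and Q for the coefficient
sequences, [dilate] for the substitution of [q ^ 2] for [q], and [conv] for the
Cauchy product, they read [conv P (dilate P) = ...], [conv E (dilate P) = ...]
and [conv P (dilate E) = ...], with right-hand sides that are divisor sums.
The coefficient of index [n] of such a product is a sum of weights
[chi (a, b, x, y) * a * b] over the positive solutions of [a x + b y = n],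
where [chi] only depends on the parities of [a, b, x, y].

Sums over these solutions are evaluated by Liouville's method.  Subtracting
the smaller of [a, b] from the larger, as in Euclid's algorithm, sends
[(a, b, x, y)] with [b < a] to [(a - b, b, x, x + y)], and the image consists
of the solutions with [x < y].  If [h] is invariant under the symmetries of
the root system A2, acting on [(a, b)] and contragrediently on [(x, y)], then
this bijection cancels everything in the sum of
[h a b x y - h a (-b) x (-y)] except the degenerate solutions [a = b] and
[x = y], which are indexed by the factorizations of [n]
([liouville_identity]).  For a quadratic form [h] in the three positive roots
[a], [b], [a + b] whose coefficients depend on parities, the difference is
[4 a b] times the coefficient of [(a + b) ^ 2] ([root_form_diff]).  For each
of the three products the symmetrized weight [chi] is such a coefficient
([cross_PP], [cross_EP], [cross_PE]), and then both sides of the coefficient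
identity agree factorization by factorization of [n], after summing squares
over even and over odd integers in an interval ([diag_term_PP],
[diag_term_EP], [diag_term_PE]).

The analytic part justifies working with coefficients.  Divisor sums have
polynomial growth, so the series converge absolutely in the unit disc, they
may be multiplied by the Cauchy product ([expands_mult]), and a second-order
Taylor bound shows that [q] times the complex derivative has the coefficients
[n c_n] ([expands_derive]). *)

(** * Finite sums over lists *)

Local Open Scope Z_scope.

Definition zsum {A : Type} (f : A -> Z) (l : list A) : Z :=
  fold_right Z.add 0 (map f l).

Lemma zsum_cons {A} (f : A -> Z) x l : zsum f (x :: l) = f x + zsum f l.
Proof. reflexivity. Qed.

Lemma zsum_app {A} (f : A -> Z) l1 l2 : zsum f (l1 ++ l2) = zsum f l1 + zsum f l2.
Proof. induction l1 as [|x l IH]; [reflexivity|]. cbn [app]. rewrite !zsum_cons, IH; ring. Qed.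

Lemma zsum_ext {A} (f g : A -> Z) l :
  (forall x, In x l -> f x = g x) -> zsum f l = zsum g l.
Proof.
induction l as [|x l IH]; intros H; [reflexivity|].
rewrite !zsum_cons, (H x (or_introl eq_refl)), IH; auto.
intros y Hy; apply H; now right.
Qed.

Lemma zsum_plus {A} (f g : A -> Z) l :
  zsum (fun x => f x + g x) l = zsum f l + zsum g l.
Proof. induction l as [|x l IH]; [reflexivity|]. rewrite !zsum_cons, IH; ring. Qed.

Lemma zsum_scal {A} c (f : A -> Z) l : zsum (fun x => c * f x) l = c * zsum f l.
Proof. induction l as [|x l IH]; [cbn; ring|]. rewrite !zsum_cons, IH; ring. Qed.

Lemma zsum_minus {A} (f g : A -> Z) l :
  zsum (fun x => f x - g x) l = zsum f l - zsum g l.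
Proof. induction l as [|x l IH]; [reflexivity|]. rewrite !zsum_cons, IH; ring. Qed.

Lemma zsum_map {A B} (f : B -> Z) (g : A -> B) l :
  zsum f (map g l) = zsum (fun x => f (g x)) l.
Proof. unfold zsum; now rewrite map_map. Qed.

Lemma zsum_flat_map {A B} (f : B -> Z) (g : A -> list B) l :
  zsum f (flat_map g l) = zsum (fun x => zsum f (g x)) l.
Proof.
induction l as [|x l IH]; [reflexivity|].
cbn [flat_map]; rewrite zsum_app, zsum_cons, IH; reflexivity.
Qed.

Lemma zsum_list_prod {A B} (f : A -> Z) (g : B -> Z) l1 l2 :
  zsum (fun p => f (fst p) * g (snd p)) (list_prod l1 l2) = zsum f l1 * zsum g l2.
Proof.
induction l1 as [|x l IH]; [reflexivity|].
cbn [list_prod]; rewrite zsum_app, zsum_cons, IH, zsum_map; cbn [fst snd].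
rewrite zsum_scal; ring.
Qed.

Lemma zsum_filter {A} (p : A -> bool) (f : A -> Z) l :
  zsum f (filter p l) = zsum (fun x => if p x then f x else 0) l.
Proof.
induction l as [|x l IH]; [reflexivity|].
rewrite zsum_cons; cbn [filter]; destruct (p x); [rewrite zsum_cons|]; rewrite IH; ring.
Qed.

Lemma zsum_perm {A} (f : A -> Z) l1 l2 : Permutation l1 l2 -> zsum f l1 = zsum f l2.
Proof.
induction 1; [reflexivity|..]; rewrite ?zsum_cons; lia.
Qed.

(** All changes of variables go through this form of invariance under
bijections: a pair of mutually inverse maps between two duplicate-free lists. *)
Lemma zsum_reindex {A B} (phi : A -> B) (psi : B -> A) (f : A -> Z) (g : B -> Z) l1 l2 :
  NoDup l1 -> NoDup l2 ->
  (forall x, In x l1 -> In (phi x) l2 /\ psi (phi x) = x /\ f x = g (phi x)) ->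
  (forall y, In y l2 -> In (psi y) l1 /\ phi (psi y) = y) ->
  zsum f l1 = zsum g l2.
Proof.
intros N1 N2 H1 H2.
rewrite (zsum_ext f (fun x => g (phi x)) l1) by (intros x Hx; now apply H1).
rewrite <- zsum_map; apply zsum_perm, NoDup_Permutation; auto.
- apply NoDup_map_NoDup_ForallPairs; auto.
  intros x y Hx Hy E; destruct (H1 x Hx) as (_ & <- & _), (H1 y Hy) as (_ & <- & _).
  now rewrite E.
- intros y; rewrite in_map_iff; split.
  + intros (x & <- & Hx); now apply H1.
  + intros Hy; exists (psi y); split; now apply H2.
Qed.

(** The blocks are disjoint because [key] recovers the block of an element. *)
Lemma NoDup_flat_map {A B} (g : A -> list B) (key : B -> A) l :
  NoDup l -> (forall x, In x l -> NoDup (g x)) ->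
  (forall x y, In y (g x) -> key y = x) -> NoDup (flat_map g l).
Proof.
intros Hl Hg Hk; induction Hl as [|x l Hx Hl IH]; cbn; [constructor|].
apply NoDup_app.
- apply Hg; now left.
- apply IH; intros y Hy; apply Hg; now right.
- intros y Hy Hy'; apply in_flat_map in Hy' as (x' & Hx' & Hy').
  apply Hk in Hy; apply Hk in Hy'; congruence.
Qed.

Lemma NoDup_list_prod {A B} (l1 : list A) (l2 : list B) :
  NoDup l1 -> NoDup l2 -> NoDup (list_prod l1 l2).
Proof.
intros H1 H2; rewrite list_prod_as_flat_map.
apply (NoDup_flat_map _ fst); auto.
- intros x _; apply NoDup_map_NoDup_ForallPairs; auto.
  intros y z _ _ E; congruence.
- intros x p Hp; apply in_map_iff in Hp as (y & <- & _); reflexivity.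
Qed.

(** * Factorizations and solutions of [a x + b y = n] *)

Definition pairs (n : nat) : list (nat * nat) :=
  map (fun d => (d, n / d)%nat) (divisors n).

Lemma in_pairs n d e : In (d, e) (pairs n) <-> (0 < d /\ 0 < e /\ d * e = n)%nat.
Proof.
unfold pairs, divisors; rewrite in_map_iff; split.
- intros (d' & E & H); injection E as -> <-.
  apply filter_In in H as [H M]; apply in_seq in H; apply Nat.eqb_eq in M.
  pose proof (Nat.div_mod n d ltac:(lia)); nia.
- intros (Hd & He & <-); exists d; split.
  + f_equal; rewrite Nat.mul_comm; apply Nat.div_mul; lia.
  + apply filter_In; split.
    * apply in_seq; nia.
    * apply Nat.eqb_eq; rewrite Nat.mul_comm; apply Nat.Div0.mod_mul.
Qed.

Lemma NoDup_pairs n : NoDup (pairs n).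
Proof.
apply NoDup_map_NoDup_ForallPairs.
- intros d e _ _ E; congruence.
- apply NoDup_filter, seq_NoDup.
Qed.

(** A solution is stored as [((a, x), (b, y))] and the list is built from the
value of [a * x]: this makes the Cauchy product of two divisor sums a sum over
[quads] by unfolding. *)
Definition quads (n : nat) : list ((nat * nat) * (nat * nat)) :=
  flat_map (fun i => list_prod (pairs i) (pairs (n - i))) (seq 1 (n - 1)).

Lemma in_quads n a x b y :
  In ((a, x), (b, y)) (quads n) <->
  (0 < a /\ 0 < x /\ 0 < b /\ 0 < y /\ a * x + b * y = n)%nat.
Proof.
unfold quads; rewrite in_flat_map; split.
- intros (i & Hi & H); apply in_seq in Hi.
  apply in_prod_iff in H as [H1 H2]; rewrite in_pairs in H1, H2; lia.
- intros H; exists (a * x)%nat; split.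
  + apply in_seq; nia.
  + apply in_prod_iff; rewrite !in_pairs; lia.
Qed.

Lemma NoDup_quads n : NoDup (quads n).
Proof.
apply (NoDup_flat_map _ (fun q => fst (fst q) * snd (fst q))%nat).
- apply seq_NoDup.
- intros i _; apply NoDup_list_prod; apply NoDup_pairs.
- intros i [[a x] [b y]] H; apply in_prod_iff in H as [H _].
  apply in_pairs in H; cbn; lia.
Qed.

(** The index set of the degenerate solutions: [a = b = d] with [x + y = e] and
[x = k], or [x = y = d] with [a + b = e] and [a = k]. *)
Definition pairs_below (n : nat) : list ((nat * nat) * nat) :=
  flat_map (fun p => map (fun k => (p, k)) (seq 1 (snd p - 1))) (pairs n).

Lemma in_pairs_below n d e k :
  In ((d, e), k) (pairs_below n) <-> (0 < d /\ 0 < k < e /\ d * e = n)%nat.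
Proof.
unfold pairs_below; rewrite in_flat_map; split.
- intros ([d' e'] & H & H'); apply in_map_iff in H' as (k' & E & Hk).
  injection E as -> -> ->; apply in_pairs in H; apply in_seq in Hk; cbn in Hk; lia.
- intros H; exists (d, e); rewrite in_pairs, in_map_iff; split; [lia|].
  exists k; rewrite in_seq; cbn; split; [reflexivity|lia].
Qed.

Lemma NoDup_pairs_below n : NoDup (pairs_below n).
Proof.
apply (NoDup_flat_map _ fst).
- apply NoDup_pairs.
- intros p _; apply NoDup_map_NoDup_ForallPairs; [|apply seq_NoDup].
  intros k l _ _ E; congruence.
- intros p q H; apply in_map_iff in H as (k & <- & _); reflexivity.
Qed.

Lemma zsum_pairs_below n (f : (nat * nat) * nat -> Z) :
  zsum f (pairs_below n) =
  zsum (fun p => zsum (fun k => f (p, k)) (seq 1 (snd p - 1))) (pairs n).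
Proof.
unfold pairs_below; rewrite zsum_flat_map.
apply zsum_ext; intros p _; apply zsum_map.
Qed.

Definition swap {A B : Type} (p : A * B) : B * A := (snd p, fst p).

Lemma zsum_pairs_swap n (f : nat * nat -> Z) :
  zsum f (pairs n) = zsum (fun p => f (swap p)) (pairs n).
Proof.
apply (zsum_reindex swap swap); try apply NoDup_pairs;
  intros [d e]; unfold swap; cbn; rewrite !in_pairs; intuition lia.
Qed.

Lemma zsum_quads_swap n (f : (nat * nat) * (nat * nat) -> Z) :
  zsum f (quads n) = zsum (fun p => f (swap p)) (quads n).
Proof.
apply (zsum_reindex swap swap); try apply NoDup_quads;
  intros [[a x] [b y]]; unfold swap; cbn; rewrite !in_quads; intuition lia.
Qed.

(** The arguments of [h] come in the order [a b x y], coefficients first. *)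
Definition at_quad (h : Z -> Z -> Z -> Z -> Z) (q : (nat * nat) * (nat * nat)) : Z :=
  h (Z.of_nat (fst (fst q))) (Z.of_nat (fst (snd q)))
    (Z.of_nat (snd (fst q))) (Z.of_nat (snd (snd q))).

(** * Liouville's method *)

Lemma zsum_trichotomy {A} (u v : A -> nat) (f : A -> Z) l :
  zsum f l =
  zsum f (filter (fun q => (v q <? u q)%nat) l) +
  zsum f (filter (fun q => (u q <? v q)%nat) l) +
  zsum f (filter (fun q => (u q =? v q)%nat) l).
Proof.
rewrite !zsum_filter, <- !zsum_plus; apply zsum_ext; intros q _.
destruct (Nat.ltb_spec (v q) (u q)), (Nat.ltb_spec (u q) (v q)),
  (Nat.eqb_spec (u q) (v q)); lia.
Qed.

(** The contribution of the factorization [N * M] of [n]: the solutions with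
[x = y = M] and [a + b = N], minus those with [a = b = N] and [x + y = M]. *)
Definition diag_term (h : Z -> Z -> Z -> Z -> Z) (p : nat * nat) : Z :=
  let N := Z.of_nat (fst p) in let M := Z.of_nat (snd p) in
  zsum (fun a => h (Z.of_nat a) (N - Z.of_nat a) M M) (seq 1 (fst p - 1)) -
  zsum (fun x => h N (- N) (Z.of_nat x) (Z.of_nat x - M)) (seq 1 (snd p - 1)).

(** Over the solutions with [b < a], the map
[(a, b, x, y) -> (a - b, b, x, x + y)] turns [h a (- b) x (- y)] into
[h] at a solution with [x < y], by the second symmetry; swapping the roles of
the two products treats [a < b].  So the regions [a <> b] of the second term
cancel the regions [x <> y] of the first one. *)
Lemma liouville_identity (h : Z -> Z -> Z -> Z -> Z) n :
  (forall a b x y, h b a y x = h a b x y) ->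
  (forall a b x y, h (a + b) (- b) x (x - y) = h a b x y) ->
  (forall a b x y, h (- a) (- b) (- x) (- y) = h a b x y) ->
  zsum (at_quad (fun a b x y => h a b x y - h a (- b) x (- y))) (quads n) =
  zsum (diag_term h) (pairs n).
Proof.
intros h_swap h_refl h_even.
set (g := fun a b x y => h a (- b) x (- y)).
change (fun a b x y => h a b x y - h a (- b) x (- y)) with
  (fun a b x y => h a b x y - g a b x y).
rewrite (zsum_ext _ (fun q => at_quad h q - at_quad g q)) by reflexivity.
rewrite zsum_minus.
rewrite (zsum_trichotomy (fun q => snd (fst q)) (fun q => snd (snd q)) (at_quad h)).
rewrite (zsum_trichotomy (fun q => fst (fst q)) (fun q => fst (snd q)) (at_quad g)).
assert (NF : forall p, NoDup (filter p (quads n)))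
  by (intros p; apply NoDup_filter, NoDup_quads).
assert (E1 : zsum (at_quad g) (filter (fun q => (fst (snd q) <? fst (fst q))%nat) (quads n))
           = zsum (at_quad h) (filter (fun q => (snd (fst q) <? snd (snd q))%nat) (quads n))).
{ apply (zsum_reindex
    (fun '((a, x), (b, y)) => ((a - b, x), (b, x + y)))%nat
    (fun '((a, x), (b, y)) => ((a + b, x), (b, y - x)))%nat); auto.
  - intros [[a x] [b y]]; rewrite !filter_In, !in_quads; cbn [fst snd].
    rewrite !Nat.ltb_lt; intros [Hq Hab]; repeat split; try lia; try nia.
    + repeat f_equal; lia.
    + unfold at_quad, g; cbn [fst snd].
      rewrite <- (h_refl (Z.of_nat (a - b))); f_equal; lia.
  - intros [[a x] [b y]]; rewrite !filter_In, !in_quads; cbn [fst snd].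
    rewrite !Nat.ltb_lt; intros [Hq Hxy]; repeat split; try lia; try nia.
    repeat f_equal; lia. }
assert (E2 : zsum (at_quad g) (filter (fun q => (fst (fst q) <? fst (snd q))%nat) (quads n))
           = zsum (at_quad h) (filter (fun q => (snd (snd q) <? snd (fst q))%nat) (quads n))).
{ apply (zsum_reindex
    (fun '((a, x), (b, y)) => ((a, x + y), (b - a, y)))%nat
    (fun '((a, x), (b, y)) => ((a, x - y), (a + b, y)))%nat); auto.
  - intros [[a x] [b y]]; rewrite !filter_In, !in_quads; cbn [fst snd].
    rewrite !Nat.ltb_lt; intros [Hq Hab]; repeat split; try lia; try nia.
    + repeat f_equal; lia.
    + unfold at_quad, g; cbn [fst snd].
      rewrite <- (h_swap (Z.of_nat a)), <- (h_refl _ (Z.of_nat a)).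
      rewrite <- h_swap, <- h_even; f_equal; lia.
  - intros [[a x] [b y]]; rewrite !filter_In, !in_quads; cbn [fst snd].
    rewrite !Nat.ltb_lt; intros [Hq Hxy]; repeat split; try lia; try nia.
    repeat f_equal; lia. }
assert (E3 : zsum (at_quad h) (filter (fun q => (snd (fst q) =? snd (snd q))%nat) (quads n))
           = zsum (fun p => zsum (fun a => h (Z.of_nat a) (Z.of_nat (fst p) - Z.of_nat a)
                (Z.of_nat (snd p)) (Z.of_nat (snd p))) (seq 1 (fst p - 1))) (pairs n)).
{ rewrite zsum_pairs_swap.
  transitivity (zsum (fun '((d, e), k) =>
     h (Z.of_nat k) (Z.of_nat e - Z.of_nat k) (Z.of_nat d) (Z.of_nat d)) (pairs_below n));
  [|rewrite zsum_pairs_below; apply zsum_ext; intros [d e] _; reflexivity].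
  apply (zsum_reindex
    (fun '((a, x), (b, y)) => ((x, a + b), a))%nat
    (fun '((d, e), k) => ((k, d), (e - k, d)))%nat); auto using NoDup_pairs_below.
  - intros [[a x] [b y]]; rewrite !filter_In, !in_quads, in_pairs_below; cbn [fst snd].
    rewrite Nat.eqb_eq; intros [Hq Hxy]; subst y; repeat split; try lia; try nia.
    + repeat f_equal; lia.
    + unfold at_quad; cbn [fst snd]; f_equal; lia.
  - intros [[d e] k]; rewrite !filter_In, !in_quads, in_pairs_below; cbn [fst snd].
    rewrite Nat.eqb_eq; intros Hq; repeat split; try lia; try nia.
    repeat f_equal; lia. }
assert (E4 : zsum (at_quad g) (filter (fun q => (fst (fst q) =? fst (snd q))%nat) (quads n))
           = zsum (fun p => zsum (fun x => h (Z.of_nat (fst p)) (- Z.of_nat (fst p))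
                (Z.of_nat x) (Z.of_nat x - Z.of_nat (snd p))) (seq 1 (snd p - 1))) (pairs n)).
{ transitivity (zsum (fun '((d, e), k) =>
     h (Z.of_nat d) (- Z.of_nat d) (Z.of_nat k) (Z.of_nat k - Z.of_nat e)) (pairs_below n));
  [|rewrite zsum_pairs_below; apply zsum_ext; intros [d e] _; reflexivity].
  apply (zsum_reindex
    (fun '((a, x), (b, y)) => ((a, x + y), x))%nat
    (fun '((d, e), k) => ((d, k), (d, e - k)))%nat); auto using NoDup_pairs_below.
  - intros [[a x] [b y]]; rewrite !filter_In, !in_quads, in_pairs_below; cbn [fst snd].
    rewrite Nat.eqb_eq; intros [Hq Hxy]; subst b; repeat split; try lia; try nia.
    + repeat f_equal; lia.
    + unfold at_quad, g; cbn [fst snd]; f_equal; lia.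
  - intros [[d e] k]; rewrite !filter_In, !in_quads, in_pairs_below; cbn [fst snd].
    rewrite Nat.eqb_eq; intros Hq; repeat split; try lia; try nia.
    repeat f_equal; lia. }
unfold diag_term; rewrite zsum_minus, E1, E2, E3, E4; ring.
Qed.

(** * Quadratic forms on the roots of A2 *)

(** The symmetries in [liouville_identity] permute, up to sign, the roots
[a, b, a + b] and simultaneously the dual quantities [y, x, x - y].  So a sum
of the three squares is invariant as soon as the coefficient of each square
depends on the parities of the root and of its dual and on parities that the
symmetries preserve: whether [a, b] are both even, whether [x, y] are both
even, and the parity of [a x + b y]. *)
Definition root_form (c : bool -> bool -> bool -> bool -> bool -> Z) (a b x y : Z) : Z :=
  let w := c (Z.even a && Z.even b)%bool (Z.even x && Z.even y)%bool
             (Z.even (a * x + b * y)) in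
  w (Z.even a) (Z.even y) * a ^ 2 + w (Z.even b) (Z.even x) * b ^ 2 +
  w (Z.even (a + b)) (Z.even (x - y)) * (a + b) ^ 2.

Ltac parity_cases :=
  rewrite ?Z.even_add, ?Z.even_mul, ?Z.even_sub, ?Z.even_opp;
  repeat match goal with |- context [Z.even ?a] =>
    is_var a; destruct (Z.even a) end; cbn [andb orb Bool.eqb xorb negb].

Lemma root_form_swap c a b x y : root_form c b a y x = root_form c a b x y.
Proof. unfold root_form; parity_cases; ring. Qed.

Lemma root_form_refl c a b x y :
  root_form c (a + b) (- b) x (x - y) = root_form c a b x y.
Proof.
unfold root_form.
replace ((a + b) * x + - b * (x - y)) with (a * x + b * y) by ring.
replace (a + b + - b) with a by ring.
replace (x - (x - y)) with y by ring.
parity_cases; ring.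
Qed.

Lemma root_form_opp c a b x y :
  root_form c (- a) (- b) (- x) (- y) = root_form c a b x y.
Proof.
unfold root_form.
replace (- a * - x + - b * - y) with (a * x + b * y) by ring.
parity_cases; ring.
Qed.

(** The coefficient of [(a + b) ^ 2] in [root_form c]; only this square
distinguishes [b] from [- b], since [x - y] and [x + y] have the same parity. *)
Definition cross (c : bool -> bool -> bool -> bool -> bool -> Z) (a b x y : Z) : Z :=
  c (Z.even a && Z.even b)%bool (Z.even x && Z.even y)%bool
    (Z.even (a * x + b * y)) (Z.even (a + b)) (Z.even (x + y)).

Lemma root_form_diff c a b x y :
  root_form c a b x y - root_form c a (- b) x (- y) = 4 * (cross c a b x y * (a * b)).
Proof.
unfold root_form, cross.
replace (a * x + - b * - y) with (a * x + b * y) by ring.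
parity_cases; ring.
Qed.

(** As [quads n] is stable under the exchange of its two products, only the
symmetrization of [chi] matters; it doubles the sum, hence 8 from the 4 of
[root_form_diff]. *)
Lemma quads_root_form c chi n :
  (forall a b x y, cross c a b x y = chi a b x y + chi b a y x) ->
  8 * zsum (at_quad (fun a b x y => chi a b x y * (a * b))) (quads n) =
  zsum (diag_term (root_form c)) (pairs n).
Proof.
intros Hchi.
rewrite <- liouville_identity by (intros; auto using root_form_swap, root_form_refl, root_form_opp).
set (F := at_quad (fun a b x y => chi a b x y * (a * b))).
transitivity (4 * (zsum F (quads n) + zsum (fun q => F (swap q)) (quads n))).
{ rewrite <- zsum_quads_swap; ring. }
rewrite <- zsum_plus, <- zsum_scal; apply zsum_ext; intros [[a x] [b y]] _.
unfold F, at_quad; cbn [fst snd swap]; rewrite root_form_diff, Hchi; ring.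
Qed.

(** * The three parity weights *)

Definition bsgn (even : bool) : Z := if even then 1 else -1.
Definition sgn (a : Z) : Z := bsgn (Z.even a).

(** The boolean arguments tell whether the following are even: both of [a, b];
both of [x, y]; [n = a x + b y]; the root [p]; its dual [q].  These functions
are found by writing the symmetrized parity weight of each product in terms of
these data with [p = a + b] and [q = x - y]; the parities of [a] and [b]
disappear thanks to that of [n]. *)
Definition weight_PP (P Q n p q : bool) : Z :=
  bsgn p * (if q then if Q then 2 else 0 else 1).
Definition weight_EP (P Q n p q : bool) : Z :=
  - (if q then if (Q && p)%bool then if P then -2 else 2 else 0 else bsgn n * bsgn p).
Definition weight_PE (P Q n p q : bool) : Z :=
  if p then if (P && q)%bool then if Q then 2 else -2 else 0 else - (bsgn n * bsgn q).

(** The parity weights of the products P(q) P(q^2), E(q) P(q^2), P(q) E(q^2),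
where [a * x] comes from the first factor and [b * y] from the second.  The
dilation makes [y] even in the series of P(q^2), where [b] is the summand of
the divisor sum, and [b] even in that of E(q^2), where [b / 2] is. *)
Definition chi_PP a b (x y : Z) := if Z.even y then sgn (a + b) else 0.
Definition chi_EP (a : Z) b (x y : Z) := if Z.even y then sgn (x + b) else 0.
Definition chi_PE (a : Z) b (x y : Z) := if Z.even b then sgn (a + y) else 0.

Lemma cross_PP a b x y : cross weight_PP a b x y = chi_PP a b x y + chi_PP b a y x.
Proof. unfold cross, chi_PP, sgn, weight_PP, bsgn; parity_cases; reflexivity. Qed.
Lemma cross_EP a b x y : cross weight_EP a b x y = chi_EP a b x y + chi_EP b a y x.
Proof. unfold cross, chi_EP, sgn, weight_EP, bsgn; parity_cases; reflexivity. Qed.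
Lemma cross_PE a b x y : cross weight_PE a b x y = chi_PE a b x y + chi_PE b a y x.
Proof. unfold cross, chi_PE, sgn, weight_PE, bsgn; parity_cases; reflexivity. Qed.

(** * The degenerate solutions *)

(** Once the parities of [N] and [M] are known, the summands of [diag_term] are
quadratic polynomials in the summation index whose coefficients depend on
its parity. *)
Definition quad_sum (p0 p1 p2 r0 r1 r2 : Z) (K : nat) : Z :=
  zsum (fun k => let a := Z.of_nat k in
    if Z.even a then p0 + p1 * a + p2 * a ^ 2 else r0 + r1 * a + r2 * a ^ 2) (seq 1 K).

Lemma zsum_seq_S (f : nat -> Z) K : zsum f (seq 1 (S K)) = zsum f (seq 1 K) + f (S K).
Proof. rewrite seq_S, zsum_app, zsum_cons; cbn; ring. Qed.

(** The factor 3 clears the denominators of the sums of squares. *)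
Lemma quad_sum_even p0 p1 p2 r0 r1 r2 m :
  let k := Z.of_nat m in
  3 * quad_sum p0 p1 p2 r0 r1 r2 (2 * m) =
  3 * (p0 + r0) * k + 3 * p1 * k * (k + 1) + 3 * r1 * k ^ 2 +
  2 * p2 * k * (k + 1) * (2 * k + 1) + r2 * k * (4 * k ^ 2 - 1).
Proof.
cbn zeta; unfold quad_sum; induction m as [|m IH]; [cbn; ring|].
replace (2 * S m)%nat with (S (S (2 * m))) by lia.
rewrite !zsum_seq_S; cbn zeta.
replace (Z.of_nat (S (2 * m))) with (2 * Z.of_nat m + 1) by lia.
replace (Z.of_nat (S (S (2 * m)))) with (2 * (Z.of_nat m + 1)) by lia.
rewrite !Z.mul_add_distr_l, IH, !Z.even_add, !Z.even_mul; cbn [Z.even orb Bool.eqb].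
replace (Z.of_nat (S m)) with (Z.of_nat m + 1) by lia; ring.
Qed.

Lemma quad_sum_odd p0 p1 p2 r0 r1 r2 m :
  let k := Z.of_nat m in
  3 * quad_sum p0 p1 p2 r0 r1 r2 (2 * m + 1) =
  3 * (p0 + r0) * k + 3 * p1 * k * (k + 1) + 3 * r1 * k ^ 2 +
  2 * p2 * k * (k + 1) * (2 * k + 1) + r2 * k * (4 * k ^ 2 - 1) +
  3 * (r0 + r1 * (2 * k + 1) + r2 * (2 * k + 1) ^ 2).
Proof.
cbn zeta; rewrite <- quad_sum_even; unfold quad_sum.
replace (2 * m + 1)%nat with (S (2 * m)) by lia; rewrite zsum_seq_S; cbn zeta.
replace (Z.of_nat (S (2 * m))) with (2 * Z.of_nat m + 1) by lia.
rewrite Z.even_add, Z.even_mul; cbn [Z.even orb Bool.eqb]; ring.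
Qed.

(** The first sum comes from [root_form c a (N - a) M M], where the dual
quantities are [M], [M], [0]; the second one from
[root_form c N (- N) x (x - M)], where the roots are [N], [- N], [0]. *)
Lemma diag_term_root_form c N M :
  let n := Z.of_nat N in let bN := Z.even n in
  let bM := Z.even (Z.of_nat M) in
  let w P Q := c P Q (bN || bM)%bool in
  diag_term (root_form c) (N, M) =
  quad_sum
    ((w bN bM bN bM + w bN bM bN true) * n ^ 2)
    (- 2 * w bN bM bN bM * n) (w bN bM true bM + w bN bM bN bM)
    ((w false bM (negb bN) bM + w false bM bN true) * n ^ 2)
    (- 2 * w false bM (negb bN) bM * n) (w false bM false bM + w false bM (negb bN) bM)
    (N - 1) -
  quad_sum ((w bN bM bN bM + w bN bM bN true) * n ^ 2) 0 0
    ((w bN false bN (negb bM) + w bN false bN false) * n ^ 2) 0 0 (M - 1).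
Proof.
cbn zeta; unfold diag_term, quad_sum; cbn [fst snd].
f_equal; apply zsum_ext; intros k _; cbn zeta;
  generalize (Z.of_nat N), (Z.of_nat M), (Z.of_nat k); intros n m a; unfold root_form.
- replace (a * m + (n - a) * m) with (n * m) by ring.
  replace (a + (n - a)) with n by ring.
  replace (m - m) with 0 by ring.
  parity_cases; change (Z.even 0) with true; cbn [negb]; ring.
- replace (n * a + - n * (a - m)) with (n * m) by ring.
  replace (n + - n) with 0 by ring.
  replace (a - (a - m)) with m by ring.
  parity_cases; change (Z.even 0) with true; cbn [negb]; ring.
Qed.

(** With this parametrization the upper bound [N - 1] of the sums is [2 * m] or
[2 * m + 1]. *)
Lemma pos_parity N : (0 < N)%nat ->
  (exists m, N = 2 * m + 1)%nat \/ (exists m, N = 2 * m + 1 + 1)%nat.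
Proof.
intros H; destruct (Nat.Even_or_Odd (N - 1)) as [[m E]|[m E]]; [left|right]; exists m; lia.
Qed.

Definition diag_PP (n m : Z) : Z :=
  3 * (- sgn n * (if Z.even m then 3 * n ^ 2 * m - 2 * n - 2 * n ^ 3 else n ^ 2 * m - n)).
Definition diag_EP (n m : Z) : Z :=
  (- sgn n) * (if Z.even m then - 2 * n ^ 3 - n ^ 2 * m - n else n ^ 2 * m) +
  (- sgn m) * (2 * n ^ 2 * m * (if Z.even n then 2 else 1) - 3 * n).
Definition diag_PE (n m : Z) : Z :=
  (- sgn n) * (2 * n ^ 3 - 2 * n - if Z.even m then 6 * n ^ 3 else 0) +
  (- sgn m) * (if Z.even n then 6 * n ^ 2 * m - 3 * n else 0).

Ltac diag_cases HN HM :=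
  destruct (pos_parity _ HN) as [[u ->]|[u ->]]; destruct (pos_parity _ HM) as [[v ->]|[v ->]];
  rewrite diag_term_root_form; unfold diag_PP, diag_EP, diag_PE; cbn zeta;
  rewrite ?Nat.add_sub, !Z.mul_sub_distr_l, ?quad_sum_even, ?quad_sum_odd; cbn zeta;
  unfold sgn; rewrite ?Nat2Z.inj_add, ?Nat2Z.inj_mul;
  cbn [Z.of_nat Pos.of_succ_nat Pos.succ];
  rewrite ?Z.even_add, ?Z.even_mul;
  change (Z.even 2) with true; change (Z.even 1) with false;
  unfold weight_PP, weight_EP, weight_PE, bsgn;
  cbn [orb Bool.eqb andb negb]; ring.

Lemma diag_term_PP N M : (0 < N)%nat -> (0 < M)%nat ->
  3 * diag_term (root_form weight_PP) (N, M) = diag_PP (Z.of_nat N) (Z.of_nat M).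
Proof. intros HN HM; diag_cases HN HM. Qed.

Lemma diag_term_EP N M : (0 < N)%nat -> (0 < M)%nat ->
  3 * diag_term (root_form weight_EP) (N, M) = diag_EP (Z.of_nat N) (Z.of_nat M).
Proof. intros HN HM; diag_cases HN HM. Qed.

Lemma diag_term_PE N M : (0 < N)%nat -> (0 < M)%nat ->
  3 * diag_term (root_form weight_PE) (N, M) = diag_PE (Z.of_nat N) (Z.of_nat M).
Proof. intros HN HM; diag_cases HN HM. Qed.

(** * The coefficient sequences *)

Definition dsum (f : Z -> Z -> Z) (n : nat) : Z :=
  zsum (fun p => f (Z.of_nat (fst p)) (Z.of_nat (snd p))) (pairs n).

Lemma pow_minus_one_pred d : (0 < d)%nat -> (-1) ^ Z.of_nat (d - 1) = - sgn (Z.of_nat d).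
Proof.
intros Hd; replace (Z.of_nat d) with (Z.of_nat (d - 1) + 1) by lia.
unfold sgn, bsgn; rewrite Z.even_add.
induction (d - 1)%nat as [|k IH]; [reflexivity|].
replace (Z.of_nat (S k)) with (Z.of_nat k + 1) by lia.
rewrite Z.pow_add_r, IH, Z.even_add by lia.
destruct (Z.even (Z.of_nat k)); reflexivity.
Qed.

Lemma in_divisors_pos n d : In d (divisors n) -> (0 < d)%nat /\ (0 < n / d)%nat.
Proof.
intros H.
assert (Hp : In (d, (n / d)%nat) (pairs n)) by (apply in_map_iff; eauto).
apply in_pairs in Hp; tauto.
Qed.

Lemma sigma_tilde_dsum s n :
  sigma_tilde s n = dsum (fun d _ => - sgn d * d ^ Z.of_nat s) n.
Proof.
unfold dsum, pairs; rewrite zsum_map; cbn [fst snd].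
apply (zsum_ext (A := nat)); intros d Hd; apply in_divisors_pos in Hd as [Hd _].
now rewrite pow_minus_one_pred.
Qed.

Lemma sigma_hat_dsum s n :
  sigma_hat s n = dsum (fun d e => - sgn e * d ^ Z.of_nat s) n.
Proof.
unfold dsum, pairs; rewrite zsum_map; cbn [fst snd].
apply (zsum_ext (A := nat)); intros d Hd; apply in_divisors_pos in Hd as [_ Hd].
now rewrite pow_minus_one_pred.
Qed.

(** The coefficients of a power series after the substitution of [q ^ 2] for
[q]. *)
Definition dilate (c : nat -> Z) (n : nat) : Z :=
  if Nat.even n then c (Nat.div2 n) else 0.

Definition conv (c d : nat -> Z) (n : nat) : Z :=
  zsum (fun k => c k * d (n - k)%nat) (seq 0 (S n)).

(** Power series with constant term 1; [dsum f 0] is an empty sum. *)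
Definition coef (f : Z -> Z -> Z) (n : nat) : Z :=
  (if (n =? 0)%nat then 1 else 0) + dsum f n.

Lemma coef_pos f n : (0 < n)%nat -> coef f n = dsum f n.
Proof. destruct n; [lia|reflexivity]. Qed.

Lemma even_of_nat n : Z.even (Z.of_nat n) = Nat.even n.
Proof.
induction n as [|n IH]; [reflexivity|].
now rewrite Nat2Z.inj_succ, Z.even_succ, Nat.even_succ, <- Z.negb_even, <- Nat.negb_even, IH.
Qed.

(** A factorization [d * e] of [n / 2] can be read as the factorization
[d * (2 e)] of [n], or as [(2 d) * e] in [dilate_coef_l].  The first reading is
used for P and Q, whose signs depend on [d], and the second one for E, whose
signs depend on [e]: the weights then depend on parities only. *)
Lemma dilate_coef_r f n :
  dilate (coef f) n = coef (fun d e => if Z.even e then f d (e / 2) else 0) n.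
Proof.
unfold dilate, coef, dsum.
rewrite (zsum_ext _ (fun p => if Nat.even (snd p) then
   f (Z.of_nat (fst p)) (Z.of_nat (Nat.div2 (snd p))) else 0) (pairs n)).
2:{ intros [d e] _; cbn [fst snd].
    now rewrite Nat2Z.inj_div2, Z.div2_div, even_of_nat. }
rewrite <- (zsum_filter (fun p => Nat.even (snd p)) (fun p =>
   f (Z.of_nat (fst p)) (Z.of_nat (Nat.div2 (snd p)))) (pairs n)).
destruct (Nat.even n) eqn:En.
- apply Nat.even_spec in En as [m ->].
  rewrite Nat.div2_double; f_equal; [destruct m; reflexivity|].
  apply (zsum_reindex (fun '(d, e) => (d, 2 * e)%nat) (fun '(d, e) => (d, Nat.div2 e)));
    auto using NoDup_pairs, NoDup_filter; intros [d e];
    rewrite ?filter_In, !in_pairs; cbn [fst snd]; rewrite Nat.even_spec.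
  + intros H; rewrite Nat.div2_double; repeat split; try nia; eexists; reflexivity.
  + intros [H [k ->]]; rewrite Nat.div2_double; repeat split; nia.
- replace (filter _ _) with (@nil (nat * nat)).
  + destruct n; [discriminate|reflexivity].
  + symmetry; destruct (filter _ _) as [|[d e] l] eqn:E; [reflexivity|].
    assert (H : In (d, e) ((d, e) :: l)) by now left.
    rewrite <- E, filter_In, in_pairs in H; cbn [snd] in H.
    destruct H as [(_ & _ & <-) H]; rewrite Nat.even_mul, H, Bool.orb_true_r in En.
    discriminate.
Qed.

Lemma coef_swap f n : coef f n = coef (fun d e => f e d) n.
Proof. unfold coef, dsum; now rewrite zsum_pairs_swap. Qed.

Lemma dilate_coef_l f n :
  dilate (coef f) n = coef (fun d e => if Z.even d then f (d / 2) e else 0) n.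
Proof.
rewrite coef_swap, <- (dilate_coef_r (fun d e => f e d)).
unfold dilate; now rewrite coef_swap.
Qed.

(** The extreme terms of the Cauchy product use the constant terms 1. *)
Lemma conv_coef f g n : (0 < n)%nat ->
  conv (coef f) (coef g) n =
  dsum f n + dsum g n +
  zsum (at_quad (fun a b x y => f a x * g b y)) (quads n).
Proof.
intros Hn; unfold conv.
rewrite seq_S, zsum_app, zsum_cons; cbn [Nat.add].
match goal with |- context [zsum ?f nil] => change (zsum f nil) with 0 end.
rewrite Nat.sub_diag.
replace (seq 0 n) with (0%nat :: seq 1 (n - 1)) by (destruct n; [lia|]; cbn; now rewrite Nat.sub_0_r).
rewrite zsum_cons, Nat.sub_0_r, !(coef_pos _ n) by lia.
assert (C0 : forall u, coef u 0 = 1) by reflexivity; rewrite !C0.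
rewrite (zsum_ext _ (fun i => dsum f i * dsum g (n - i)) (seq 1 (n - 1))).
2:{ intros i Hi; apply in_seq in Hi; rewrite !coef_pos by lia; reflexivity. }
unfold quads; rewrite zsum_flat_map.
rewrite (zsum_ext (fun i => zsum _ (list_prod _ _)) (fun i => dsum f i * dsum g (n - i))).
- ring.
- intros i _; unfold dsum; rewrite <- zsum_list_prod; reflexivity.
Qed.

Definition cP := coef (fun d _ => - 8 * sgn d * d).
Definition cE := coef (fun d e => - 24 * sgn e * d).
Definition cQ := coef (fun d _ => 16 * sgn d * d ^ 3).

Lemma dsum_scal c f n : c * dsum f n = dsum (fun d e => c * f d e) n.
Proof. symmetry; apply zsum_scal. Qed.
Lemma dsum_plus f g n : dsum f n + dsum g n = dsum (fun d e => f d e + g d e) n.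
Proof. symmetry; apply zsum_plus. Qed.
Lemma dsum_index f n : Z.of_nat n * dsum f n = dsum (fun d e => d * e * f d e) n.
Proof.
rewrite dsum_scal; apply zsum_ext; intros [d e] H; apply in_pairs in H; cbn [fst snd].
replace n with (d * e)%nat by tauto; now rewrite Nat2Z.inj_mul.
Qed.
Lemma dsum_ext f g n :
  (forall d e, (0 < d)%nat -> (0 < e)%nat ->
     f (Z.of_nat d) (Z.of_nat e) = g (Z.of_nat d) (Z.of_nat e)) ->
  dsum f n = dsum g n.
Proof.
intros H; apply zsum_ext; intros [d e] Hp; apply in_pairs in Hp; cbn [fst snd]; apply H; lia.
Qed.

(** The evaluation of the sum over solutions: 8 comes from [quads_root_form]
and 3 from the closed forms of [diag_term]. *)
Lemma quads_dsum k chi c F G n :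
  (forall a b x y, F a b x y = k * (chi a b x y * (a * b))) ->
  (forall a b x y, cross c a b x y = chi a b x y + chi b a y x) ->
  (forall d e, (0 < d)%nat -> (0 < e)%nat ->
    3 * diag_term (root_form c) (d, e) = G (Z.of_nat d) (Z.of_nat e)) ->
  24 * zsum (at_quad F) (quads n) = k * dsum G n.
Proof.
intros HF Hchi HG.
rewrite (zsum_ext _ (fun q => k * at_quad (fun a b x y => chi a b x y * (a * b)) q))
  by (intros q _; apply HF).
rewrite zsum_scal.
replace (dsum G n) with (3 * zsum (diag_term (root_form c)) (pairs n)).
- rewrite <- (quads_root_form c chi n Hchi); ring.
- rewrite <- zsum_scal; apply zsum_ext; intros [d e] Hp.
  apply in_pairs in Hp; cbn [fst snd]; apply HG; lia.
Qed.

Lemma sgn_add a b : sgn (a + b) = sgn a * sgn b.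
Proof. unfold sgn, bsgn; rewrite Z.even_add; destruct (Z.even a), (Z.even b); reflexivity. Qed.

Lemma even_half a : Z.even a = true -> a = 2 * (a / 2).
Proof.
intros H; apply Z.even_spec in H as [k ->]; rewrite (Z.mul_comm 2 k), Z.div_mul; lia.
Qed.

Lemma conv_ext c c' d d' n :
  (forall k, c k = c' k) -> (forall k, d k = d' k) -> conv c d n = conv c' d' n.
Proof. intros Hc Hd; apply zsum_ext; intros k _; now rewrite Hc, Hd. Qed.

(** * The identities between coefficients *)

(** In each of the three proofs all terms become divisor sums, over the
factorizations [d * e] of [n], and the summands agree for each parity of
[d] and [e].  Multiplying by 24 makes [quads_dsum] applicable. *)
Lemma conv_P_dilate_P n :
  conv cP (dilate cP) n =
  dilate cQ n + Z.of_nat n * cP n + 2 * (Z.of_nat n * dilate cP n).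
Proof.
destruct (Nat.eq_dec n 0) as [->|Hn]; [reflexivity|].
unfold cP, cQ.
rewrite (conv_ext _ _ _ _ n (fun k => eq_refl) (dilate_coef_r _)).
rewrite conv_coef, !dilate_coef_r, !coef_pos, !dsum_index by lia.
(* 64 = 8 * 8, from the factors 8 of the two series P *)
match goal with |- _ + zsum (at_quad ?F) _ = _ =>
  pose proof (quads_dsum 64 chi_PP weight_PP F diag_PP n ltac:(intros; unfold chi_PP; rewrite sgn_add;
   destruct (Z.even y); ring) cross_PP diag_term_PP) as H end.
apply (Z.mul_reg_l _ _ 24); [lia|].
match goal with |- 24 * (?A + ?S) = _ => replace (24 * (A + S)) with (24 * A + 24 * S) by ring end.
rewrite H; clear H.
repeat (rewrite ?dsum_plus, ?dsum_scal).
apply dsum_ext; intros d e _ _; generalize (Z.of_nat d), (Z.of_nat e); intros n0 m0;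
  unfold diag_PP.
destruct (Z.even m0); ring.
Qed.

Lemma conv_E_dilate_P n :
  3 * conv cE (dilate cP) n =
  3 * dilate cQ n + 2 * (Z.of_nat n * cE n + 2 * (Z.of_nat n * dilate cE n))
  + 3 * (Z.of_nat n * cP n + - 2 * (Z.of_nat n * dilate cP n)).
Proof.
destruct (Nat.eq_dec n 0) as [->|Hn]; [reflexivity|].
unfold cP, cQ, cE.
rewrite (conv_ext _ _ _ _ n (fun k => eq_refl) (dilate_coef_r _)).
rewrite conv_coef, (dilate_coef_l (fun d e => -24 * sgn e * d)), !dilate_coef_r, !coef_pos,
  !dsum_index by lia.
(* 192 = 24 * 8, from the factors of E and P *)
match goal with |- _ * (_ + zsum (at_quad ?F) _) = _ =>
  pose proof (quads_dsum 192 chi_EP weight_EP F diag_EP n ltac:(intros; unfold chi_EP; rewrite sgn_add;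
   destruct (Z.even y); ring) cross_EP diag_term_EP) as H end.
apply (Z.mul_reg_l _ _ 24); [lia|].
match goal with |- 24 * (3 * (?A + ?S)) = _ =>
  replace (24 * (3 * (A + S))) with (72 * A + 3 * (24 * S)) by ring end.
rewrite H; clear H.
repeat (rewrite ?dsum_plus, ?dsum_scal).
apply dsum_ext; intros d e _ _; generalize (Z.of_nat d), (Z.of_nat e); intros n0 m0;
  unfold diag_EP.
destruct (Z.even m0), (Z.even n0) eqn:En; try apply even_half in En;
  try set (k := n0 / 2) in *; try clearbody k; subst; ring.
Qed.

Lemma conv_P_dilate_E n :
  2 * conv cP (dilate cE) n =
  3 * dilate cQ n + - 1 * cQ n + 4 * (Z.of_nat n * dilate cE n).
Proof.
destruct (Nat.eq_dec n 0) as [->|Hn]; [reflexivity|].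
unfold cP, cQ, cE.
rewrite (conv_ext _ _ _ _ n (fun k => eq_refl) (dilate_coef_l _)).
rewrite conv_coef, (dilate_coef_l (fun d e => -24 * sgn e * d)), !dilate_coef_r, !coef_pos,
  !dsum_index by lia.
(* 96 = 8 * 24 / 2, as the summand of the divisor sum in E(q^2) is b / 2 *)
match goal with |- _ * (_ + zsum (at_quad ?F) _) = _ =>
  pose proof (quads_dsum 96 chi_PE weight_PE F diag_PE n ltac:(intros; unfold chi_PE; rewrite sgn_add;
   destruct (Z.even b) eqn:Eb; [rewrite (even_half b Eb) at 2|]; ring) cross_PE diag_term_PE) as H end.
apply (Z.mul_reg_l _ _ 24); [lia|].
match goal with |- 24 * (2 * (?A + ?S)) = _ =>
  replace (24 * (2 * (A + S))) with (48 * A + 2 * (24 * S)) by ring end.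
rewrite H; clear H.
repeat (rewrite ?dsum_plus, ?dsum_scal).
apply dsum_ext; intros d e _ _; generalize (Z.of_nat d), (Z.of_nat e); intros n0 m0;
  unfold diag_PE.
destruct (Z.even m0), (Z.even n0) eqn:En; try apply even_half in En;
  try set (k := n0 / 2) in *; try clearbody k; subst; ring.
Qed.

Local Close Scope Z_scope.

(** * Complex series *)

Notation Cseries a l := (@is_series C_AbsRing C_NormedModule a l).

Lemma sum_n_Re_Im (a : nat -> C) n :
  @sum_n C_NormedModule a n =
  (sum_n (fun k => Re (a k)) n, sum_n (fun k => Im (a k)) n).
Proof.
induction n as [|n IH].
- rewrite !sum_O; destruct (a O); reflexivity.
- rewrite !sum_Sn, IH; reflexivity.
Qed.

(** Convergence in C is componentwise, which reduces the Cauchy product of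
complex series to the real one. *)
Lemma is_series_C (a : nat -> C) (l : C) :
  Cseries a l <->
  is_series (fun n => Re (a n)) (Re l) /\ is_series (fun n => Im (a n)) (Im l).
Proof.
split.
- intros H; split; intros P HP; destruct HP as [eps He].
  + destruct (proj1 (filterlim_locally _ _) H eps) as [N HN]; exists N; intros n Hn.
    apply He; specialize (HN n Hn); rewrite sum_n_Re_Im in HN; apply HN.
  + destruct (proj1 (filterlim_locally _ _) H eps) as [N HN]; exists N; intros n Hn.
    apply He; specialize (HN n Hn); rewrite sum_n_Re_Im in HN; apply HN.
- intros [H1 H2]; apply filterlim_locally; intros eps.
  destruct (proj1 (filterlim_locally _ _) H1 eps) as [N1 HN1].
  destruct (proj1 (filterlim_locally _ _) H2 eps) as [N2 HN2].
  exists (max N1 N2); intros n Hn; rewrite sum_n_Re_Im; split.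
  + apply HN1; lia.
  + apply HN2; lia.
Qed.

Lemma ex_series_C_le (a : nat -> C) (b : nat -> R) :
  (forall n, Cmod (a n) <= b n)%R -> ex_series b -> exists l, Cseries a l.
Proof. intros H Hb; exact (@ex_series_le C_AbsRing C_CompleteNormedModule a b H Hb). Qed.

Lemma Cseries_unique (a : nat -> C) l l' : Cseries a l -> Cseries a l' -> l = l'.
Proof. intros H H'; rewrite <- (CSeries_unique a l H); now apply CSeries_unique. Qed.

Lemma Cseries_ext (a b : nat -> C) l :
  (forall n, a n = b n) -> Cseries a l -> Cseries b l.
Proof. apply is_series_ext. Qed.

Lemma Cseries_le (a : nat -> C) (b : nat -> R) (l : C) (m : R) :
  (forall n, Cmod (a n) <= b n)%R -> Cseries a l -> is_series b m -> (Cmod l <= m)%R.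
Proof.
intros H Ha Hb.
assert (L1 : is_lim_seq (fun n => Cmod (@sum_n C_NormedModule a n)) (Cmod l)).
{ exact (filterlim_comp _ _ _ _ _ _ _ _ Ha
    (@filterlim_norm C_AbsRing C_NormedModule l)). }
refine (is_lim_seq_le _ _ (Cmod l) m _ L1 Hb).
intros n; eapply Rle_trans; [apply (@norm_sum_n_m C_AbsRing C_NormedModule)|].
apply sum_n_m_le; exact H.
Qed.

(** Real and imaginary parts are absolutely convergent, so the four real Cauchy
products exist. *)
Lemma Cseries_mult (a b : nat -> C) (la lb : C) :
  Cseries a la -> Cseries b lb ->
  ex_series (fun n => Cmod (a n)) -> ex_series (fun n => Cmod (b n)) ->
  Cseries (fun n => @sum_n C_NormedModule (fun k => a k * b (n - k)%nat) n) (la * lb).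
Proof.
intros Ha Hb Na Nb.
assert (Abs : forall c, ex_series (fun n => Cmod (c n)) ->
  ex_series (fun n => Rabs (Re (c n))) /\ ex_series (fun n => Rabs (Im (c n)))).
{ intros c Hc; split; refine (ex_series_le _ _ _ Hc); intros n;
    (eapply Rle_trans; [right; apply Rabs_Rabsolu|]);
    (eapply Rle_trans; [|apply Rmax_Cmod]); [apply Rmax_l|apply Rmax_r]. }
apply is_series_C in Ha as [Ra Ia]; apply is_series_C in Hb as [Rb Ib].
destruct (Abs a Na) as [ARa AIa], (Abs b Nb) as [ARb AIb].
apply is_series_C; split.
- eapply is_series_ext;
    [|exact (is_series_minus _ _ _ _ (is_series_mult _ _ _ _ Ra Rb ARa ARb)
               (is_series_mult _ _ _ _ Ia Ib AIa AIb))].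
  intros n; rewrite sum_n_Re_Im; cbn [Re fst]; rewrite sum_n_Reals.
  symmetry; apply (minus_sum (fun k => Re (a k) * Re (b (n - k)%nat))%R).
- eapply is_series_ext;
    [|exact (is_series_plus _ _ _ _ (is_series_mult _ _ _ _ Ra Ib ARa AIb)
               (is_series_mult _ _ _ _ Ia Rb AIa ARb))].
  intros n; rewrite sum_n_Re_Im; cbn [Im snd]; rewrite sum_n_Reals.
  symmetry; apply (plus_sum (fun k => Re (a k) * Im (b (n - k)%nat))%R).
Qed.

(** * Power series with coefficients of polynomial growth *)

Definition poly_bounded (c : nat -> Z) : Prop :=
  exists (K : R) (k : nat), forall n, (Rabs (IZR (c n)) <= K * INR (S n) ^ k)%R.

Lemma ex_series_poly_geom k r : (0 < r < 1)%R ->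
  ex_series (fun n => INR (S n) ^ k * r ^ n)%R.
Proof.
intros Hr.
assert (Hpos : forall n, (0 < INR (S n) ^ k * r ^ n)%R).
{ intros n; apply Rmult_lt_0_compat; apply pow_lt; [apply lt_0_INR; lia|lra]. }
apply ex_series_Rabs, (ex_series_DAlembert _ (1 * r)); [lra| |].
- intros n; specialize (Hpos n); lra.
- apply is_lim_seq_ext with (fun n => (INR (S (S n)) / INR (S n)) ^ k * r)%R.
  + intros n; rewrite Rabs_pos_eq.
    * unfold Rdiv; rewrite Rpow_mult_distr, pow_inv, <- tech_pow_Rmult; field.
      repeat split; try apply pow_nonzero; first [lra|apply not_0_INR; lia].
    * apply Rlt_le, Rdiv_lt_0_compat; apply Hpos.
  + apply (is_lim_seq_mult' _ _ 1 r); [|apply is_lim_seq_const].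
    assert (L : is_lim_seq (fun n => INR (S (S n)) / INR (S n))%R 1).
    { apply is_lim_seq_ext with (fun n => 1 + / INR (S n))%R.
      - intros n; rewrite (S_INR (S n)); field; apply not_0_INR; lia.
      - replace (Finite 1) with (Finite (1 + 0)) by (f_equal; ring).
        apply is_lim_seq_plus'; [apply is_lim_seq_const|].
        apply (is_lim_seq_incr_1 (fun n => / INR n)%R).
        change (Finite 0) with (Rbar_inv p_infty).
        apply is_lim_seq_inv; [apply is_lim_seq_INR|discriminate]. }
    clear Hpos; induction k as [|k IH]; [apply is_lim_seq_const|].
    replace (Finite 1) with (Finite (1 * 1)) by (f_equal; ring).
    apply (is_lim_seq_mult' _ _ 1 1); assumption.
Qed.

(** The radius [(1 + r) / 2] in the proof is positive even if [r] is zero, as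
the ratio test requires. *)
Lemma ex_series_poly_bounded c r : poly_bounded c -> (0 <= r < 1)%R ->
  ex_series (fun n => Rabs (IZR (c n)) * r ^ n)%R.
Proof.
intros (K & k & Hc) Hr.
apply (@ex_series_le R_AbsRing R_CompleteNormedModule _
  (fun n => K * (INR (S n) ^ k * ((1 + r) / 2) ^ n))%R).
- intros n.
  assert (P1 : (0 <= r ^ n <= ((1 + r) / 2) ^ n)%R)
    by (split; [apply pow_le|apply pow_incr]; lra).
  pose proof (Rabs_pos (IZR (c n))) as P2.
  eapply Rle_trans; [right; apply Rabs_pos_eq, Rmult_le_pos; lra|].
  rewrite <- Rmult_assoc; apply Rmult_le_compat; [lra..|apply Hc|lra].
- apply (ex_series_scal_l K (fun n => INR (S n) ^ k * ((1 + r) / 2) ^ n)%R).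
  apply ex_series_poly_geom; lra.
Qed.

Definition expands (c : nat -> Z) (q v : C) : Prop :=
  Cseries (fun n => RtoC (IZR (c n)) * q ^ n) v.

Lemma Cmod_coef c q n :
  Cmod (RtoC (IZR (c n)) * q ^ n) = (Rabs (IZR (c n)) * Cmod q ^ n)%R.
Proof. now rewrite Cmod_mult, Cmod_R, Cmod_pow. Qed.

Lemma poly_bounded_abs c q : poly_bounded c -> (Cmod q < 1)%R ->
  ex_series (fun n => Cmod (RtoC (IZR (c n)) * q ^ n)).
Proof.
intros Hc Hq; eapply ex_series_ext; [intros n; symmetry; apply Cmod_coef|].
apply ex_series_poly_bounded; [assumption|split; [apply Cmod_ge_0|assumption]].
Qed.

Lemma expands_ex c q : poly_bounded c -> (Cmod q < 1)%R -> exists v, expands c q v.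
Proof.
intros Hc Hq; eapply ex_series_C_le; [|apply (poly_bounded_abs c q Hc Hq)].
intros n; apply Rle_refl.
Qed.

Lemma expands_unique c d q v w :
  expands c q v -> expands d q w -> (forall n, c n = d n) -> v = w.
Proof.
intros Hv Hw H; apply (Cseries_unique _ v w Hv).
eapply Cseries_ext; [|exact Hw]; intros n; cbn; now rewrite H.
Qed.

Lemma expands_plus c d q v w :
  expands c q v -> expands d q w -> expands (fun n => (c n + d n)%Z) q (v + w).
Proof.
intros Hv Hw; eapply Cseries_ext; [|exact (is_series_plus _ _ _ _ Hv Hw)].
intros n; cbn; rewrite plus_IZR, RtoC_plus; change plus with Cplus; ring.
Qed.

Lemma expands_scal k c q v :
  expands c q v -> expands (fun n => (k * c n)%Z) q (RtoC (IZR k) * v).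
Proof.
intros Hv; eapply Cseries_ext;
  [|exact (@is_series_scal C_AbsRing C_NormedModule (RtoC (IZR k)) _ _ Hv)].
intros n; rewrite mult_IZR, RtoC_mult; change scal with Cmult; ring.
Qed.

(** Presents an equation between elements of the normed module C as one in the
field C, which is what [ring] recognizes. *)
Ltac Cring :=
  change plus with Cplus;
  match goal with |- @eq _ ?a ?b => change (@eq C a b) end; ring.

Lemma sum_n_conv c d q n :
  @sum_n C_NormedModule (fun k => RtoC (IZR (c k)) * q ^ k *
     (RtoC (IZR (d (n - k)%nat)) * q ^ (n - k))) n = RtoC (IZR (conv c d n)) * q ^ n.
Proof.
unfold conv.
assert (H : forall N, (N <= n)%nat ->
  @sum_n C_NormedModule (fun k => RtoC (IZR (c k)) * q ^ k *
     (RtoC (IZR (d (n - k)%nat)) * q ^ (n - k))) N =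
  RtoC (IZR (zsum (fun k => (c k * d (n - k)%nat)%Z) (seq 0 (S N)))) * q ^ n).
{ assert (E : forall k, (k <= n)%nat -> q ^ n = q ^ k * q ^ (n - k))
    by (intros k Hk; rewrite <- Cpow_add_r; f_equal; lia).
  induction N as [|N IH]; intros HN.
  - rewrite sum_O, (E O) by lia; cbn [seq]; rewrite zsum_cons.
    change (zsum _ nil) with 0%Z; rewrite Z.add_0_r, mult_IZR, RtoC_mult; Cring.
  - rewrite sum_Sn, IH, (seq_S (S N)), zsum_app, zsum_cons by lia.
    change (zsum _ nil) with 0%Z; change plus with Cplus; cbn [Nat.add].
    rewrite Z.add_0_r, plus_IZR, mult_IZR, RtoC_plus, RtoC_mult, (E (S N) HN) at 1.
    rewrite (E (S N) HN); Cring. }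
apply H; lia.
Qed.

Lemma expands_mult c d q v w :
  poly_bounded c -> poly_bounded d -> (Cmod q < 1)%R ->
  expands c q v -> expands d q w -> expands (conv c d) q (v * w).
Proof.
intros Hc Hd Hq Hv Hw; eapply Cseries_ext; [|exact (Cseries_mult _ _ _ _ Hv Hw
  (poly_bounded_abs c q Hc Hq) (poly_bounded_abs d q Hd Hq))].
intros n; apply sum_n_conv.
Qed.

(** The terms of odd index vanish, so partial sums of the dilated series repeat
those of the original one. *)
Lemma sum_n_dilate c q N :
  @sum_n C_NormedModule (fun n => RtoC (IZR (dilate c n)) * q ^ n) N =
  @sum_n C_NormedModule (fun n => RtoC (IZR (c n)) * (q ^ 2) ^ n) (Nat.div2 N).
Proof.
assert (H : forall m,
  @sum_n C_NormedModule (fun n => RtoC (IZR (dilate c n)) * q ^ n) (2 * m) =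
  @sum_n C_NormedModule (fun n => RtoC (IZR (c n)) * (q ^ 2) ^ n) m /\
  @sum_n C_NormedModule (fun n => RtoC (IZR (dilate c n)) * q ^ n) (S (2 * m)) =
  @sum_n C_NormedModule (fun n => RtoC (IZR (c n)) * (q ^ 2) ^ n) m).
{ assert (Hodd : forall m, dilate c (S (2 * m)) = 0%Z).
  { intros m; unfold dilate; now rewrite Nat.even_succ, Nat.odd_mul. }
  assert (Heven : forall m, dilate c (2 * m) = c m).
  { intros m; unfold dilate; now rewrite Nat.even_mul, Nat.div2_double. }
  induction m as [|m [_ IH]].
  - rewrite sum_Sn, !sum_O, Hodd; split; [reflexivity|].
    change plus with Cplus; cbn -[RtoC]; Cring.
  - assert (E : @sum_n C_NormedModule (fun n => RtoC (IZR (dilate c n)) * q ^ n) (2 * S m)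
              = @sum_n C_NormedModule (fun n => RtoC (IZR (c n)) * (q ^ 2) ^ n) (S m)).
    { replace (2 * S m)%nat with (S (S (2 * m))) by lia.
      rewrite sum_Sn, IH, sum_Sn; f_equal.
      replace (S (S (2 * m))) with (2 * S m)%nat by lia.
      now rewrite Heven, Cpow_mult_r. }
    split; [exact E|].
    rewrite sum_Sn, E, Hodd; Cring. }
destruct (Nat.Even_or_Odd N) as [[m ->]|[m ->]].
- rewrite Nat.div2_double; apply H.
- rewrite Nat.add_1_r, Nat.div2_succ_double; apply H.
Qed.

Lemma expands_dilate c q v : expands c (q ^ 2) v -> expands (dilate c) q v.
Proof.
intros H P HP; destruct (H P HP) as [N HN]; exists (2 * N)%nat; intros n Hn.
rewrite sum_n_dilate; apply HN.
rewrite Nat.div2_div; apply Nat.div_le_lower_bound; lia.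
Qed.

Lemma poly_bounded_dilate c : poly_bounded c -> poly_bounded (dilate c).
Proof.
intros (K & k & H); exists K, k; intros n.
assert (HK : (0 <= K)%R).
{ specialize (H O); rewrite pow1, Rmult_1_r in H.
  eapply Rle_trans; [apply Rabs_pos|exact H]. }
assert (P : (0 <= INR (S n))%R) by apply pos_INR.
unfold dilate; destruct (Nat.even n).
- eapply Rle_trans; [apply H|].
  apply Rmult_le_compat_l, pow_incr; [assumption|split; [apply pos_INR|apply le_INR]].
  apply le_n_S, Nat.div2_decr; lia.
- rewrite Rabs_R0; apply Rmult_le_pos; [assumption|now apply pow_le].
Qed.

(** The effect on coefficients of the Euler operator [q d/dq]. *)
Definition euler (c : nat -> Z) (n : nat) : Z := (Z.of_nat n * c n)%Z.

Lemma poly_bounded_euler c : poly_bounded c -> poly_bounded (euler c).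
Proof.
intros (K & k & H); exists K, (S k); intros n; unfold euler.
rewrite mult_IZR, <- INR_IZR_INZ, Rabs_mult, (Rabs_pos_eq (INR n)) by apply pos_INR.
replace (K * INR (S n) ^ S k)%R with (INR (S n) * (K * INR (S n) ^ k))%R by (cbn [pow]; ring).
apply Rmult_le_compat; [apply pos_INR|apply Rabs_pos|apply le_INR; lia|apply H].
Qed.

(** With [A n] the remainder, [A (n + 1) = z A n + n q ^ (n - 1) (z - q) ^ 2],
and the bound follows by induction.  The factor [r ^ 2] avoids the exponent
[n - 2]. *)
Lemma Cmod_taylor2 (z q : C) (r : R) n :
  (0 < r)%R -> (Cmod z <= r)%R -> (Cmod q <= r)%R ->
  (Cmod (z ^ n - q ^ n - RtoC (INR n) * q ^ pred n * (z - q)) * r ^ 2 <=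
   INR n ^ 2 * r ^ n * Cmod (z - q) ^ 2)%R.
Proof.
intros Hr Hz Hq.
set (A := fun n => z ^ n - q ^ n - RtoC (INR n) * q ^ pred n * (z - q)); fold (A n).
set (delta := Cmod (z - q)); assert (Hd : (0 <= delta)%R) by apply Cmod_ge_0.
induction n as [|n IH].
{ replace (A O) with (RtoC 0) by (unfold A; cbn -[RtoC]; ring).
  rewrite Cmod_0; cbn; nra. }
assert (E : A (S n) = z * A n + RtoC (INR n) * q ^ pred n * (z - q) ^ 2).
{ unfold A; rewrite S_INR, RtoC_plus; cbn [pred]; rewrite !Cpow_S.
  destruct n as [|n]; cbn [pred]; [cbn -[RtoC]; ring|].
  rewrite !Cpow_S; ring. }
assert (B : (Cmod (A (S n)) <= r * Cmod (A n) + INR n * r ^ pred n * delta ^ 2)%R).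
{ rewrite E; eapply Rle_trans; [apply Cmod_triangle|].
  rewrite !Cmod_mult, !Cmod_pow, Cmod_R, (Rabs_pos_eq (INR n)) by apply pos_INR.
  apply Rplus_le_compat.
  - apply Rmult_le_compat_r; [apply Cmod_ge_0|assumption].
  - apply Rmult_le_compat_r; [apply pow_le; assumption|].
    apply Rmult_le_compat_l; [apply pos_INR|].
    apply pow_incr; split; [apply Cmod_ge_0|assumption]. }
assert (F : (INR n * r ^ pred n * r = INR n * r ^ n)%R)
  by (destruct n; cbn [pred pow]; [cbn|]; ring).
assert (P : (0 <= r ^ n * delta ^ 2)%R)
  by (apply Rmult_le_pos; [apply pow_le; lra|apply pow_le; assumption]).
pose proof (pos_INR n) as Pn.
apply Rle_trans with ((r * Cmod (A n) + INR n * r ^ pred n * delta ^ 2) * r ^ 2)%R.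
{ apply Rmult_le_compat_r; [apply pow_le; lra|exact B]. }
replace ((r * Cmod (A n) + INR n * r ^ pred n * delta ^ 2) * r ^ 2)%R
  with (r * (Cmod (A n) * r ^ 2) + (INR n * r ^ pred n * r) * r * delta ^ 2)%R by ring.
rewrite F, S_INR; cbn [pow] in *.
apply Rle_trans with (r * (INR n * (INR n * 1) * r ^ n * (delta * (delta * 1))) +
  INR n * r ^ n * r * (delta * (delta * 1)))%R.
{ apply Rplus_le_compat_r, Rmult_le_compat_l; [lra|exact IH]. }
replace ((INR n + 1) * ((INR n + 1) * 1) * (r * r ^ n) * (delta * (delta * 1)))%R
  with (r * (INR n * (INR n * 1) * r ^ n * (delta * (delta * 1))) +
  INR n * r ^ n * r * (delta * (delta * 1)) + r * ((INR n + 1) * (r ^ n * (delta * (delta * 1)))))%R by ring.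
assert (0 <= r * ((INR n + 1) * (r ^ n * (delta * (delta * 1)))))%R; [|lra].
apply Rmult_le_pos; [lra|apply Rmult_le_pos; lra].
Qed.

(** Summing the Taylor bounds for the powers shows that
[f z - f q - (z - q) D] is at most a constant times [|z - q| ^ 2] near [q];
the constant is finite because [n ^ 2 c_n] has polynomial growth too. *)
Lemma expands_derive (c : nat -> Z) (f : C -> C) (q : C) :
  poly_bounded c -> (forall z, (Cmod z < 1)%R -> expands c z (f z)) -> (Cmod q < 1)%R ->
  exists D, @is_derive C_AbsRing C_NormedModule f q D /\ expands (euler c) q (q * D).
Proof.
intros Hc Hf Hq.
pose proof (Cmod_ge_0 q) as Hq0.
(* a radius between that of q and 1, leaving room for z around q *)
set (r := ((1 + Cmod q) / 2)%R).
assert (Hr : (0 < r < 1)%R) by (unfold r; lra).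
assert (Hqr : (Cmod q <= r)%R) by (unfold r; lra).
assert (ED : exists D, Cseries (fun n => RtoC (IZR (euler c n)) * q ^ pred n) D).
{ apply ex_series_C_le with (fun n => / r * (Rabs (IZR (euler c n)) * r ^ n))%R.
  - intros [|n]; [unfold euler; cbn -[RtoC pow]; rewrite Cmult_0_l, Cmod_0, Rabs_R0; lra|].
    cbn [pred]; rewrite Cmod_mult, Cmod_R, Cmod_pow.
    replace (/ r * (Rabs (IZR (euler c (S n))) * r ^ S n))%R
      with (Rabs (IZR (euler c (S n))) * r ^ n)%R by (cbn [pow]; field; lra).
    apply Rmult_le_compat_l; [apply Rabs_pos|apply pow_incr; split; assumption].
  - apply (ex_series_scal_l (/ r)%R (fun n => Rabs (IZR (euler c n)) * r ^ n)%R).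
    apply ex_series_poly_bounded; [now apply poly_bounded_euler|lra]. }
destruct ED as [D HD]; exists D; split.
2:{ eapply Cseries_ext; [|exact (@is_series_scal C_AbsRing C_NormedModule q _ _ HD)].
    intros n; change scal with Cmult; cbn beta.
    destruct n as [|n]; [unfold euler; cbn -[RtoC]; ring|cbn [pred]; rewrite Cpow_S; ring]. }
destruct (ex_series_poly_bounded (euler (euler c)) r) as [M HM];
  [now apply poly_bounded_euler, poly_bounded_euler|lra|].
assert (Hbound : forall z, (Cmod z <= r)%R ->
  (Cmod (f z - f q - (z - q) * D) <= M / r ^ 2 * Cmod (z - q) ^ 2)%R).
{ intros z Hz.
  assert (S1 : Cseries (fun n => RtoC (IZR (c n)) *
      (z ^ n - q ^ n - RtoC (INR n) * q ^ pred n * (z - q))) (f z - f q - (z - q) * D)).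
  { eapply Cseries_ext; [|exact (is_series_minus _ _ _ _
      (is_series_minus _ _ _ _ (Hf z ltac:(lra)) (Hf q Hq))
      (@is_series_scal C_AbsRing C_NormedModule (z - q) _ _ HD))].
    intros n; change scal with Cmult; change plus with Cplus; change opp with Copp; cbn beta.
    unfold euler; rewrite mult_IZR, <- INR_IZR_INZ, RtoC_mult; Cring. }
  pose proof (is_series_scal (/ r ^ 2 * Cmod (z - q) ^ 2)%R _ _ HM) as S2.
  replace (M / r ^ 2 * Cmod (z - q) ^ 2)%R with (/ r ^ 2 * Cmod (z - q) ^ 2 * M)%R
    by (field; lra).
  refine (Cseries_le _ _ _ _ _ S1 S2); intros n; change scal with Rmult; cbn beta.
  rewrite Cmod_mult, Cmod_R.
  pose proof (Cmod_taylor2 z q r n ltac:(lra) Hz Hqr) as T.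
  unfold euler; rewrite !mult_IZR, !Rabs_mult, <- !INR_IZR_INZ, !(Rabs_pos_eq (INR n)) by apply pos_INR.
  apply Rmult_le_reg_r with (r ^ 2)%R; [apply pow_lt; lra|].
  replace (/ r ^ 2 * Cmod (z - q) ^ 2 * (INR n * (INR n * Rabs (IZR (c n))) * r ^ n) * r ^ 2)%R
    with (Rabs (IZR (c n)) * (INR n ^ 2 * r ^ n * Cmod (z - q) ^ 2))%R by (field; lra).
  rewrite Rmult_assoc; apply Rmult_le_compat_l; [apply Rabs_pos|exact T]. }
split; [apply (@is_linear_scal_l C_AbsRing C_NormedModule)|].
intros x Hx; apply (@is_filter_lim_locally_unique C_AbsRing (AbsRing_NormedModule C_AbsRing)) in Hx.
subst x; intros eps.
set (B := (Rabs (M / r ^ 2) + 1)%R).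
assert (HB : (0 < B)%R) by (unfold B; pose proof (Rabs_pos (M / r ^ 2)); lra).
assert (Hdelta : (0 < Rmin (r - Cmod q) (eps / B))%R).
{ apply Rmin_pos; [unfold r; lra|apply Rdiv_lt_0_compat; [apply cond_pos|exact HB]]. }
exists (mkposreal _ Hdelta); intros z Hz.
change (Cmod (z - q) < Rmin (r - Cmod q) (eps / B))%R in Hz.
change (Cmod (f z - f q - (z - q) * D) <= eps * Cmod (z - q))%R.
pose proof (Rmin_l (r - Cmod q) (eps / B)) as R1.
pose proof (Rmin_r (r - Cmod q) (eps / B)) as R2.
assert (Hzr : (Cmod z <= r)%R).
{ replace z with (z - q + q) by ring.
  eapply Rle_trans; [apply Cmod_triangle|lra]. }
eapply Rle_trans; [apply (Hbound z Hzr)|].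
replace (M / r ^ 2 * Cmod (z - q) ^ 2)%R with (M / r ^ 2 * Cmod (z - q) * Cmod (z - q))%R by ring.
apply Rmult_le_compat_r; [apply Cmod_ge_0|].
apply Rle_trans with (B * Cmod (z - q))%R.
- apply Rmult_le_compat_r; [apply Cmod_ge_0|unfold B; pose proof (Rle_abs (M / r ^ 2)); lra].
- apply Rle_trans with (B * (eps / B))%R; [apply Rmult_le_compat_l; lra|].
  right; field; lra.
Qed.

(** There are at most [n] divisors of [n], each of them at most [n]. *)
Lemma poly_bounded_coef (f : Z -> Z -> Z) (K : Z) (s : nat) :
  (forall d e, (0 < d)%nat -> (Z.abs (f (Z.of_nat d) (Z.of_nat e)) <= K * Z.of_nat d ^ Z.of_nat s)%Z) ->
  poly_bounded (coef f).
Proof.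
intros Hf.
assert (HK : (0 <= K)%Z).
{ specialize (Hf 1%nat O ltac:(lia)); rewrite Z.pow_1_l in Hf by lia; lia. }
exists (IZR (K + 1)), (S s); intros n.
rewrite <- abs_IZR, INR_IZR_INZ, pow_IZR, <- mult_IZR; apply IZR_le.
assert (L : forall l, (forall p, In p l -> (0 < fst p <= n)%nat) ->
  (Z.abs (zsum (fun p => f (Z.of_nat (fst p)) (Z.of_nat (snd p))) l) <=
   Z.of_nat (length l) * (K * Z.of_nat n ^ Z.of_nat s))%Z).
{ induction l as [|p l IH]; intros Hl; [cbn; lia|].
  rewrite zsum_cons; cbn [length]; rewrite Nat2Z.inj_succ.
  specialize (IH (fun p' Hp => Hl p' (or_intror Hp))).
  destruct (Hl p (or_introl eq_refl)) as [Hp1 Hp2].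
  specialize (Hf (fst p) (snd p) Hp1).
  assert (Z.of_nat (fst p) ^ Z.of_nat s <= Z.of_nat n ^ Z.of_nat s)%Z
    by (apply Z.pow_le_mono_l; lia).
  nia. }
specialize (L (pairs n)).
assert (Hlen : (length (pairs n) <= n)%nat).
{ unfold pairs, divisors; rewrite length_map.
  eapply Nat.le_trans; [apply filter_length_le|rewrite length_seq; lia]. }
unfold coef, dsum.
assert (LB := L ltac:(intros [d e] Hp; apply in_pairs in Hp; cbn; nia)); clear L.
replace (Z.of_nat (S n) ^ Z.of_nat (S s))%Z
  with (Z.of_nat (S n) * Z.of_nat (S n) ^ Z.of_nat s)%Z
  by (rewrite (Nat2Z.inj_succ s), Z.pow_succ_r; lia).
assert (P1 : (0 <= Z.of_nat n ^ Z.of_nat s <= Z.of_nat (S n) ^ Z.of_nat s)%Z)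
  by (split; [apply Z.pow_nonneg; lia|apply Z.pow_le_mono_l; lia]).
assert (P2 : (1 <= Z.of_nat (S n) ^ Z.of_nat s)%Z)
  by (rewrite <- (Z.pow_1_l (Z.of_nat s)) by lia; apply Z.pow_le_mono_l; lia).
assert (P3 : (Z.of_nat (length (pairs n)) * (K * Z.of_nat n ^ Z.of_nat s) <=
  Z.of_nat (S n) * (K * Z.of_nat (S n) ^ Z.of_nat s))%Z)
  by (apply Z.mul_le_mono_nonneg; nia).
destruct (n =? 0)%nat; nia.
Qed.

Lemma abs_sgn a : Z.abs (sgn a) = 1%Z.
Proof. unfold sgn, bsgn; destruct (Z.even a); reflexivity. Qed.

Lemma poly_bounded_cP : poly_bounded cP.
Proof.
apply (poly_bounded_coef _ 8 1); intros d e _; rewrite !Z.abs_mul, abs_sgn; lia.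
Qed.
Lemma poly_bounded_cE : poly_bounded cE.
Proof.
apply (poly_bounded_coef _ 24 1); intros d e _; rewrite !Z.abs_mul, abs_sgn; lia.
Qed.
Lemma poly_bounded_cQ : poly_bounded cQ.
Proof.
apply (poly_bounded_coef _ 16 3); intros d e _; rewrite !Z.abs_mul, abs_sgn, Z.abs_pow.
rewrite (Z.abs_eq (Z.of_nat d)) by lia; lia.
Qed.

(** * The functions P, E and Q *)

(** The total operator behind [gen_series] returns a value also for divergent
series, so its link with the expansion goes through convergence; dividing by
[k] recovers the series of [c] from that of [coef f]. *)
Lemma gen_series_expands (k : Z) (f : Z -> Z -> Z) (c : nat -> Z) q :
  (forall n, k * c n = dsum f n)%Z -> (k <> 0)%Z -> poly_bounded (coef f) -> (Cmod q < 1)%R ->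
  expands (coef f) q (1 + RtoC (IZR k) * gen_series c q).
Proof.
intros Hc Hk Hb Hq.
destruct (expands_ex _ q Hb Hq) as [v Hv].
assert (Hk' : RtoC (IZR k) <> 0) by (intros E; apply RtoC_inj, eq_IZR in E; contradiction).
replace (1 + RtoC (IZR k) * gen_series c q) with v; [exact Hv|].
assert (S1 : Cseries (fun n => RtoC (IZR (coef f (S n))) * q ^ S n) (v - 1)).
{ apply (@is_series_incr_1 C_AbsRing C_NormedModule
    (fun n => RtoC (IZR (coef f n)) * q ^ n)).
  replace (plus (v - 1) _) with v; [exact Hv|].
  unfold coef, dsum; cbn -[RtoC]; Cring. }
assert (S2 : gen_series c q = / RtoC (IZR k) * (v - 1)).
{ apply CSeries_unique; eapply Cseries_ext;
    [|exact (@is_series_scal C_AbsRing C_NormedModule (/ RtoC (IZR k)) _ _ S1)].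
  intros n; cbn beta; rewrite coef_pos, <- Hc, mult_IZR, RtoC_mult by lia.
  change scal with Cmult; field; exact Hk'. }
rewrite S2; field; exact Hk'.
Qed.

Lemma calP_expands q : (Cmod q < 1)%R -> expands cP q (calP q).
Proof.
apply (gen_series_expands 8); [|discriminate|apply poly_bounded_cP].
intros n; rewrite sigma_tilde_dsum, dsum_scal; apply dsum_ext; intros.
change (Z.of_nat 1) with 1%Z; ring.
Qed.

Lemma calE_expands q : (Cmod q < 1)%R -> expands cE q (calE q).
Proof.
apply (gen_series_expands 24); [|discriminate|apply poly_bounded_cE].
intros n; rewrite sigma_hat_dsum, dsum_scal; apply dsum_ext; intros.
change (Z.of_nat 1) with 1%Z; ring.
Qed.

Lemma calQ_expands q : (Cmod q < 1)%R -> expands cQ q (calQ q).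
Proof.
intros Hq; unfold calQ.
replace (1 - 16 * gen_series (sigma_tilde 3) q)
  with (1 + RtoC (IZR (-16)) * gen_series (sigma_tilde 3) q)
  by (change (IZR (-16)) with (- (16))%R; rewrite RtoC_opp; ring).
revert Hq; apply (gen_series_expands (-16)); [|discriminate|apply poly_bounded_cQ].
intros n; rewrite sigma_tilde_dsum, dsum_scal; apply dsum_ext; intros.
change (Z.of_nat 3) with 3%Z; ring.
Qed.

Theorem theorem4p4 (q : C) (hq : (Cmod q < 1)%R) :
  (C_ex_derive calP q /\ C_ex_derive calP2 q /\
   C_ex_derive calE q /\ C_ex_derive calE2 q) /\
  calP q * calP (q ^ 2) =
    calQ (q ^ 2) + q * C_derive calP q + 2 * q * C_derive calP2 q /\
  calP (q ^ 2) * calE q =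
    calQ (q ^ 2)
    + 2 / 3 * (q * C_derive calE q + 2 * q * C_derive calE2 q)
    + (q * C_derive calP q - 2 * q * C_derive calP2 q) /\
  calP q * calE (q ^ 2) =
    1 / 2 * (3 * calQ (q ^ 2) - calQ q) + 2 * q * C_derive calE2 q.
Proof.
assert (Hsq : forall z, (Cmod z < 1)%R -> (Cmod (z ^ 2) < 1)%R).
{ intros z Hz; rewrite Cmod_pow; pose proof (Cmod_ge_0 z); cbn [pow]; nra. }
assert (HP2 : forall z, (Cmod z < 1)%R -> expands (dilate cP) z (calP2 z))
  by (intros z Hz; apply expands_dilate, calP_expands, Hsq, Hz).
assert (HE2 : forall z, (Cmod z < 1)%R -> expands (dilate cE) z (calE2 z))
  by (intros z Hz; apply expands_dilate, calE_expands, Hsq, Hz).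
pose proof (expands_dilate _ _ _ (calQ_expands _ (Hsq _ hq))) as HQ2.
pose proof (calQ_expands q hq) as HQ.
pose proof poly_bounded_cP as BP; pose proof poly_bounded_cE as BE.
pose proof (poly_bounded_dilate _ BP) as BP2; pose proof (poly_bounded_dilate _ BE) as BE2.
destruct (expands_derive cP calP q BP calP_expands hq) as (DP & dP & XP).
destruct (expands_derive _ calP2 q BP2 HP2 hq) as (DP2 & dP2 & XP2).
destruct (expands_derive cE calE q BE calE_expands hq) as (DE & dE & XE).
destruct (expands_derive _ calE2 q BE2 HE2 hq) as (DE2 & dE2 & XE2).
split; [repeat split; eexists; eassumption|].
rewrite (is_C_derive_unique _ _ _ dP), (is_C_derive_unique _ _ _ dP2),
  (is_C_derive_unique _ _ _ dE), (is_C_derive_unique _ _ _ dE2).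
specialize (HP2 q hq); specialize (HE2 q hq).
pose proof (calP_expands q hq) as HP; pose proof (calE_expands q hq) as HE.
split; [|split].
- transitivity (calQ (q ^ 2) + q * DP + 2 * (q * DP2)); [|ring].
  exact (expands_unique _ _ _ _ _ (expands_mult _ _ _ _ _ BP BP2 hq HP HP2)
    (expands_plus _ _ _ _ _ (expands_plus _ _ _ _ _ HQ2 XP) (expands_scal 2 _ _ _ XP2))
    conv_P_dilate_P).
- pose proof (expands_unique _ _ _ _ _
    (expands_scal 3 _ _ _ (expands_mult _ _ _ _ _ BE BP2 hq HE HP2))
    (expands_plus _ _ _ _ _
      (expands_plus _ _ _ _ _ (expands_scal 3 _ _ _ HQ2)
        (expands_scal 2 _ _ _ (expands_plus _ _ _ _ _ XE (expands_scal 2 _ _ _ XE2))))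
      (expands_scal 3 _ _ _ (expands_plus _ _ _ _ _ XP (expands_scal (-2) _ _ _ XP2))))
    conv_E_dilate_P) as H.
  fold (calP2 q).
  assert (H3 : RtoC 3 <> 0) by (intros E; apply RtoC_inj in E; lra).
  transitivity (/ 3 * (3 * (calE q * calP2 q))); [field; exact H3|].
  rewrite H; change (IZR (-2)) with (- (2))%R; rewrite RtoC_opp; field; exact H3.
- pose proof (expands_unique _ _ _ _ _
    (expands_scal 2 _ _ _ (expands_mult _ _ _ _ _ BP BE2 hq HP HE2))
    (expands_plus _ _ _ _ _
      (expands_plus _ _ _ _ _ (expands_scal 3 _ _ _ HQ2) (expands_scal (-1) _ _ _ HQ))
      (expands_scal 4 _ _ _ XE2))
    conv_P_dilate_E) as H.
  fold (calE2 q).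
  assert (H2 : RtoC 2 <> 0) by (intros E; apply RtoC_inj in E; lra).
  transitivity (/ 2 * (2 * (calP q * calE2 q))); [field; exact H2|].
  rewrite H; change (IZR (-1)) with (- (1))%R; rewrite RtoC_opp.
  replace (RtoC 4) with (RtoC 2 * RtoC 2) by (rewrite <- RtoC_mult; f_equal; lra).
  field; exact H2.
Qed.
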